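(* Let $n\ge2$ and consider the interconnection $$\dot x_j\in F_j(x,u),\ j=1,\dots,n,\quad (x,u)\in\mathcal C;\qquad x_j^+\in G_j(x,u),\ j=1,\dots,n,\quad (x,u)\in\mathcal D,$$ of hybrid subsystems $\Sigma_1,\dots,\Sigma_n$, where each $\Sigma_j$ admits a candidate exponential ISS Lyapunov function $V_j:\mathcal X_j\to\mathbb R_+$ w.r.t. a nonempty compact set $\mathcal A_j\subset\mathcal X_j$ with rate coefficients $c_j,d_j\in\mathbb R$, internal gains $\chi_{jk}$ and external gain $\chi_j$. Let $I_d:=\{j:d_j<0\}$, and consider the augmented interconnection $\tilde\Sigma$ (defined in the context) in which each subsystem with index $j\in I_d$ is augmented with an average dwell-time clock $\tau_j\in[0,N_{0j}]$ with integer $N_{0j}\ge1$ and $\delta_j>0$. For scalars $L_j\ge0$, define $W_j:\mathcal Z_j\to\mathbb R_+$, $j=1,\dots,n$, by $$W_j(z_j):=\begin{cases}V_j(x_j)&\text{if }j\notin I_d;\\ e^{L_j\tau_j}V_j(x_j)&\text{if }j\in I_d.\end{cases}$$ Then for each $i\in\{1,\dots,n\}$, $W_i$ is a candidate exponential ISS Lyapunov function w.r.t. $$\tilde{\mathcal A}_i:=\begin{cases}\mathcal A_i&\text{if }i\notin I_d;\\ \mathcal A_i\times[0,N_{0i}]&\text{if }i\in I_d\end{cases}$$ for the augmented subsystem $\tilde\Sigma_i$ with rate coefficients $$\begin{cases}\tilde c_i:=c_i,\ \tilde d_i:=d_i&\text{if }i\notin I_d;\\ \tilde c_i:=c_i-L_i\delta_i,\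 \tilde d_i:=d_i+L_i&\text{if }i\in I_d.\end{cases}$$ More specifically, $W_i$ is locally Lipschitz outside $\tilde{\mathcal A}_i$ and: 1. there exist $\tilde\psi_{i1},\tilde\psi_{i2}\in\mathcal K_\infty$ such that $\tilde\psi_{i1}(|z_i|_{\tilde{\mathcal A}_i})\le W_i(z_i)\le\tilde\psi_{i2}(|z_i|_{\tilde{\mathcal A}_i})$ for all $z_i\in\mathcal Z_i$; 2. with internal gains $\tilde\chi_{ij}\in\mathcal K$, $j\ne i$, defined by $$\tilde\chi_{ij}(r):=\begin{cases}\chi_{ij}(r)&\text{if }i\notin I_d;\\ e^{L_iN_{0i}}\chi_{ij}(r)&\text{if }i\in I_d\end{cases}$$ and $\tilde\chi_{ii}\equiv0$, there exists an external gain $\tilde\chi_i\in\mathcal K$ such that for all $(z,u)\in\tilde{\mathcal C}$ with $z_i\notin\tilde{\mathcal A}_i$, $$W_i(z_i)\ge\max\Big\{\max_{j=1}^n\tilde\chi_{ij}(W_j(z_j)),\,\tilde\chi_i(|u|)\Big\}$$ implies $$\dot W_i(z_i;y_i)\le-\tilde c_iW_i(z_i)\qquad\forall y_i\in\tilde F_i(z,u);$$ 3. for all $(z,u)\in\tilde{\mathcal D}$ (with the same $\tilde\chi_{ij},\tilde\chi_i$), $$W_i(y_i)\le\max\Big\{e^{-\tilde d_i}W_i(z_i),\,\max_{j=1}^n\tilde\chi_{ij}(W_j(z_j)),\,\tilde\chi_i(|u|)\Big\}\qquad\forall y_i\in\tilde G_i(z,u).$$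
   Context: Notation. $\mathbb R_+=[0,\infty)$; $|\cdot|$ is the Euclidean norm and $|x|_{\mathcal A}=\inf_{y\in\mathcal A}|x-y|$. $\alpha:\mathbb R_+\to\mathbb R_+$ is of class $\mathcal K$ if continuous, strictly increasing and $\alpha(0)=0$; of class $\mathcal K_\infty$ if in addition unbounded. The Dini derivative of a locally Lipschitz $V$ at $x$ in direction $y$ is $\dot V(x;y):=\limsup_{h\searrow0}\frac{V(x+hy)-V(x)}{h}$ (over $h>0$ for which $V(x+hy)$ is defined). Interconnection. $x=(x_1,\dots,x_n)\in\mathcal X=\mathcal X_1\times\cdots\times\mathcal X_n$ with $x_j\in\mathcal X_j\subset\mathbb R^{N_j}$ is the state; $u\in\mathcal U\subset\mathbb R^M$ is the common external input; $\mathcal C=\mathcal C_1\times\cdots\times\mathcal C_n\times\mathcal C_u$ with $\mathcal C_j\subset\mathcal X_j$, $\mathcal C_u\subset\mathcal U$ is the flow set; $\mathcal D=\mathcal D_1\times\cdots\times\mathcal D_n\times\mathcal D_u$ with $\mathcal D_j\subset\mathcal X_j$, $\mathcal D_u\subset\mathcal U$ is the jump set; $F_j:\mathcal C\rightrightarrows\mathbb R^{N_j}$ and $G_j:\mathcal D\rightrightarrows\mathcal X_j$ are set-valued maps. The dynamics of $x_j$ is the subsystem $\Sigma_j$. Candidate exponential ISS Lyapunov function for a subsystem. $V_i:\mathcal X_i\to\mathbb R_+$ is a candidate exponential ISS Lyapunov function w.r.t. $\mathcal A_i$ for $\Sigma_i$ with rate coefficients $c_i,d_i\in\mathbb R$ if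 it is locally Lipschitz outside $\mathcal A_i$ and: (1) there are $\psi_{i1},\psi_{i2}\in\mathcal K_\infty$ with $\psi_{i1}(|x_i|_{\mathcal A_i})\le V_i(x_i)\le\psi_{i2}(|x_i|_{\mathcal A_i})$ for all $x_i\in\mathcal X_i$; (2) there are internal gains $\chi_{ij}\in\mathcal K$ for $j\ne i$, $\chi_{ii}\equiv0$, and an external gain $\chi_i\in\mathcal K$ such that for all $(x,u)\in\mathcal C$ with $x_i\notin\mathcal A_i$, $V_i(x_i)\ge\max\{\max_{j=1}^n\chi_{ij}(V_j(x_j)),\chi_i(|u|)\}$ implies $\dot V_i(x_i;y_i)\le-c_iV_i(x_i)$ for all $y_i\in F_i(x,u)$; (3) for all $(x,u)\in\mathcal D$ and all $y_i\in G_i(x,u)$, $V_i(y_i)\le\max\{e^{-d_i}V_i(x_i),\max_{j=1}^n\chi_{ij}(V_j(x_j)),\chi_i(|u|)\}$. Augmented interconnection. For $j\notin I_d$: $z_j:=x_j\in\mathcal Z_j:=\mathcal X_j$, $\tilde{\mathcal C}_j:=\mathcal C_j$, $\tilde{\mathcal D}_j:=\mathcal D_j$, $\tilde F_j(z,u):=F_j(x,u)$, $\tilde G_j(z,u):=G_j(x,u)$. For $j\in I_d$: $z_j:=(x_j,\tau_j)\in\mathcal Z_j:=\mathcal X_j\times[0,N_{0j}]$, $\tilde{\mathcal C}_j:=\mathcal C_j\times[0,N_{0j}]$, $\tilde{\mathcal D}_j:=\mathcal D_j\times[1,N_{0j}]$, $\tilde F_j(z,u):=F_j(x,u)\times[0,\delta_j]$,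 $\tilde G_j(z,u):=G_j(x,u)\times\{\tau_j-1\}$. The augmented interconnection $\tilde\Sigma$ has state $z=(z_1,\dots,z_n)\in\mathcal Z_1\times\cdots\times\mathcal Z_n$, input $u\in\mathcal U$, flow set $\tilde{\mathcal C}:=\tilde{\mathcal C}_1\times\cdots\times\tilde{\mathcal C}_n\times\mathcal C_u$, jump set $\tilde{\mathcal D}:=\tilde{\mathcal D}_1\times\cdots\times\tilde{\mathcal D}_n\times\mathcal D_u$, and dynamics $\dot z_j\in\tilde F_j(z,u)$ for $(z,u)\in\tilde{\mathcal C}$, $z_j^+\in\tilde G_j(z,u)$ for $(z,u)\in\tilde{\mathcal D}$, $j=1,\dots,n$; $x$ denotes the vector of $x$-components of $z$. The dynamics of $z_j$ is the augmented subsystem $\tilde\Sigma_j$. *)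

(* Defs.v *)
From HB Require Import structures.
From mathcomp Require Import all_boot all_order all_algebra.
From mathcomp Require Import all_classical all_reals all_analysis.
Import Order.TTheory GRing.Theory Num.Theory numFieldNormedType.Exports.

Set Implicit Arguments.
Unset Strict Implicit.
Unset Printing Implicit Defensive.

Local Open Scope classical_set_scope.
Local Open Scope ring_scope.

(* The library norm `|x| on 'rV[R]_N is the sup norm, hence this definition;
   both norms induce the same topology. *)
Definition enorm (R : realType) (N : nat) (x : 'rV[R]_N) : R :=
  Num.sqrt (\sum_(k < N) x 0 k ^+ 2).

Definition set_dist (R : realType) (N : nat) (A : set 'rV[R]_N) (x : 'rV[R]_N)
  : R := inf [set enorm (x - y) | y in A].

(* Functions from R_+ to R_+ are represented by functions on R of which only
   the restriction to [0, +oo[ matters. *)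
Definition classK (R : realType) (alpha : R -> R) : Prop :=
  [/\ {within `[0, +oo[, continuous alpha},
      forall r s, 0 <= r -> r < s -> alpha r < alpha s
    & alpha 0 = 0].

Definition classKoo (R : realType) (alpha : R -> R) : Prop :=
  classK alpha /\ forall B, exists2 r, 0 <= r & B < alpha r.

(* The functions V below are total, but stand for functions defined on X only.
   The limsup is taken in \bar R; it is -oo if no small h > 0 keeps x + h y
   in X. *)
Definition dini (R : realType) (N : nat) (X : set 'rV[R]_N) (V : 'rV[R]_N -> R)
    (x y : 'rV[R]_N) : \bar R :=
  limf_esup (fun h : R => ((V (x + h *: y) - V x) / h)%:E)
            (within [set h : R | X (x + h *: y)] 0^'+).

Definition locally_lipschitz_outside (R : realType) (N : nat)
    (X A : set 'rV[R]_N) (V : 'rV[R]_N -> R) : Prop :=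
  forall x, (X `\` A) x -> exists K e : R, 0 < e /\
    forall y z, (X `\` A) y -> (X `\` A) z ->
      enorm (y - x) < e -> enorm (z - x) < e ->
      `|V y - V z| <= K * enorm (y - z).

(* flow j x u and jump j x u are meaningful only for (x, u) in the flow set,
   resp. in the jump set. *)
Unset Implicit Arguments.
Record interconnection (R : realType) (n M : nat) := Interconnection {
  state_dim : 'I_n -> nat;
  state_space : forall j, set 'rV[R]_(state_dim j);
  inputs : set 'rV[R]_M;
  flow_dom : forall j, set 'rV[R]_(state_dim j);
  flow_inputs : set 'rV[R]_M;
  jump_dom : forall j, set 'rV[R]_(state_dim j);
  jump_inputs : set 'rV[R]_M;
  flow : forall j, (forall k, 'rV[R]_(state_dim k)) -> 'rV[R]_M -> set 'rV[R]_(state_dim j);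
  jump : forall j, (forall k, 'rV[R]_(state_dim k)) -> 'rV[R]_M -> set 'rV[R]_(state_dim j);
  flow_dom_sub : forall j, flow_dom j `<=` state_space j;
  flow_inputs_sub : flow_inputs `<=` inputs;
  jump_dom_sub : forall j, jump_dom j `<=` state_space j;
  jump_inputs_sub : jump_inputs `<=` inputs;
  jump_sub : forall j x u, (forall k, jump_dom k (x k)) -> jump_inputs u ->
    jump j x u `<=` state_space j }.
Set Implicit Arguments.
Arguments state_dim {R n M} _.
Arguments state_space {R n M} _.
Arguments inputs {R n M} _.
Arguments flow_dom {R n M} _.
Arguments flow_inputs {R n M} _.
Arguments jump_dom {R n M} _.
Arguments jump_inputs {R n M} _.
Arguments flow {R n M} _.
Arguments jump {R n M} _.


Definition state (R : realType) (n M : nat) (S : interconnection R n M) :=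
  forall j, 'rV[R]_(state_dim S j).

Definition flow_set (R : realType) (n M : nat) (S : interconnection R n M)
    (x : state S) (u : 'rV[R]_M) : Prop :=
  (forall j, flow_dom S j (x j)) /\ flow_inputs S u.

Definition jump_set (R : realType) (n M : nat) (S : interconnection R n M)
    (x : state S) (u : 'rV[R]_M) : Prop :=
  (forall j, jump_dom S j (x j)) /\ jump_inputs S u.

(* max { max_j chi_ij (V_j (x_j)), chi_i (|u|) }.  Taking 0 as the default of
   the inner maximum is harmless, since its term j = i is chi_ii = 0. *)
Definition gain_max (R : realType) (n M : nat) (S : interconnection R n M)
    (V : forall j, 'rV[R]_(state_dim S j) -> R) (chi : 'I_n -> R -> R)
    (chiu : R -> R) (x : state S) (u : 'rV[R]_M) : R :=
  Num.max (\big[Num.max/0]_(j < n) chi j (V j (x j))) (chiu (enorm u)).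

(* V i is a candidate exponential ISS Lyapunov function w.r.t. A for the i-th
   subsystem of S, with rate coefficients c and d, internal gains chi j and
   external gain chiu. *)
Definition candidate_exp_ISS_Lyapunov (R : realType) (n M : nat)
    (S : interconnection R n M) (V : forall j, 'rV[R]_(state_dim S j) -> R)
    (i : 'I_n) (A : set 'rV[R]_(state_dim S i)) (c d : R)
    (chi : 'I_n -> R -> R) (chiu : R -> R) : Prop :=
  [/\ (forall x, state_space S i x -> 0 <= V i x) /\
      locally_lipschitz_outside (state_space S i) A (V i),
      exists psi1 psi2 : R -> R, [/\ classKoo psi1, classKoo psi2 &
        forall x, state_space S i x ->
          psi1 (set_dist A x) <= V i x <= psi2 (set_dist A x)],
      [/\ forall j, j != i -> classK (chi j),
          forall r, 0 <= r -> chi i r = 0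
        & classK chiu],
      forall (x : state S) u, flow_set x u -> ~ A (x i) ->
        gain_max V chi chiu x u <= V i (x i) ->
        forall y, flow S i x u y ->
          (dini (state_space S i) (V i) (x i) y <= (- c * V i (x i))%:E)%E
    & forall (x : state S) u, jump_set x u ->
        forall y, jump S i x u y ->
          V i y <= Num.max (expR (- d) * V i (x i)) (gain_max V chi chiu x u)].

(* The state z_j of the j-th augmented subsystem lives in
   'rV_(N_j + (j \in I)), where (j \in I) : bool is read as 0 or 1: its left
   block lsubmx is x_j, and its right block is the clock tau_j if j \in I and
   is empty otherwise. *)
Definition clock_in (R : realType) (N : nat) (b : bool) (lo hi : R)
    (z : 'rV[R]_(N + b)) : Prop :=
  forall k : 'I_b, lo <= rsubmx z 0 k <= hi.

(* tau if b holds, and 0 (an empty sum) otherwise *)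
Definition clock (R : realType) (N : nat) (b : bool) (z : 'rV[R]_(N + b)) : R :=
  \sum_(k < b) rsubmx z 0 k.

(* B * [lo, hi] if b holds, and B otherwise *)
Definition with_clock (R : realType) (N : nat) (b : bool) (lo hi : R)
    (B : set 'rV[R]_N) : set 'rV[R]_(N + b) :=
  [set z | B (lsubmx z) /\ clock_in lo hi z].

Arguments flow_dom_sub {R n M} _.
Arguments flow_inputs_sub {R n M} _.
Arguments jump_dom_sub {R n M} _.
Arguments jump_inputs_sub {R n M} _.

Unset Implicit Arguments.
Section Augmented.
Context (R : realType) (n M : nat) (S : interconnection R n M).
Context (I : {pred 'I_n}) (N0 : 'I_n -> nat) (delta : 'I_n -> R).

Definition aug_dim (j : 'I_n) : nat := (state_dim S j + (j \in I))%N.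

Definition xpart (z : forall k, 'rV[R]_(aug_dim k)) : state S :=
  fun k => lsubmx (z k).

Definition aug_space j : set 'rV[R]_(aug_dim j) :=
  with_clock 0 (N0 j)%:R (state_space S j).

Definition aug_flow_dom j : set 'rV[R]_(aug_dim j) :=
  with_clock 0 (N0 j)%:R (flow_dom S j).

Definition aug_jump_dom j : set 'rV[R]_(aug_dim j) :=
  with_clock 1 (N0 j)%:R (jump_dom S j).

Definition aug_flow j (z : forall k, 'rV[R]_(aug_dim k)) (u : 'rV[R]_M) :
    set 'rV[R]_(aug_dim j) :=
  with_clock 0 (delta j) (flow S j (xpart z) u).

Definition aug_jump j (z : forall k, 'rV[R]_(aug_dim k)) (u : 'rV[R]_M) :
    set 'rV[R]_(aug_dim j) :=
  [set y | jump S j (xpart z) u (lsubmx y) /\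
           rsubmx y = rsubmx (z j) - const_mx 1].

Lemma aug_flow_dom_sub j : aug_flow_dom j `<=` aug_space j.
Proof. by move=> z [? ?]; split=> //; exact: flow_dom_sub. Qed.

Lemma aug_jump_dom_sub j : aug_jump_dom j `<=` aug_space j.
Proof.
move=> z [Dz tz]; split; first exact: jump_dom_sub.
move=> k; have /andP[t1 ->] := tz k.
by rewrite (le_trans ler01 t1).
Qed.

Lemma aug_jump_sub j z u : (forall k, aug_jump_dom k (z k)) -> jump_inputs S u ->
  aug_jump j z u `<=` aug_space j.
Proof.
move=> Dz Du y [Gy ty]; split.
  by apply: jump_sub Gy => // k; have [] := Dz k.
move=> k; have [_ /(_ k)/andP[t1 tN]] := Dz j.
by rewrite ty !mxE in t1 tN *; rewrite subr_ge0 t1 lerBlDr ler_wpDr.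
Qed.

Definition augmented : interconnection R n M :=
  Interconnection R n M aug_dim aug_space (inputs S)
    aug_flow_dom (flow_inputs S) aug_jump_dom (jump_inputs S)
    aug_flow aug_jump
    aug_flow_dom_sub (flow_inputs_sub S)
    aug_jump_dom_sub (jump_inputs_sub S) aug_jump_sub.

End Augmented.
Set Implicit Arguments.
Arguments augmented {R n M} S I N0 delta.

Definition I_d (R : realType) (n : nat) (d : 'I_n -> R) : {pred 'I_n} :=
  [pred j | d j < 0].

Definition W (R : realType) (n M : nat) (S : interconnection R n M)
    (I : {pred 'I_n}) (N0 : 'I_n -> nat) (delta L : 'I_n -> R)
    (V : forall j, 'rV[R]_(state_dim S j) -> R) :
    forall j, 'rV[R]_(state_dim (augmented S I N0 delta) j) -> R :=
  fun j (z : 'rV[R]_(state_dim S j + (j \in I))) =>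
    if j \in I then expR (L j * clock z) * V j (lsubmx z)
    else V j (lsubmx z).

Definition aug_gain (R : realType) (n : nat) (I : {pred 'I_n})
    (N0 : 'I_n -> nat) (L : 'I_n -> R) (chi : 'I_n -> 'I_n -> R -> R)
    (i j : 'I_n) (r : R) : R :=
  if j == i then 0
  else if i \in I then expR (L i * (N0 i)%:R) * chi i j r
  else chi i j r.

(* Main.v *)
Require Import Defs.
From HB Require Import structures.
From mathcomp Require Import all_boot all_order all_algebra.
From mathcomp Require Import all_classical all_reals all_analysis.
From mathcomp Require Import ring lra.
Import Order.TTheory GRing.Theory Num.Theory numFieldNormedType.Exports.
Set Implicit Arguments.
Unset Strict Implicit.
Unset Printing Implicit Defensive.

Local Open Scope classical_set_scope.
Local Open Scope ring_scope.

(** Both cases of the definition of [W] are instances of one formula,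
    [exp (l_j * clock z_j) * V_j x_j], with [l_j = L_j] when a clock is present
    and [l_j = 0] otherwise (the clock then reads 0 as well); the case
    distinctions in the gains and the rate coefficients collapse in the same
    way.  It remains to see what the weight [exp (l * tau)] does to each
    property of a candidate Lyapunov function.

    - Since [0 <= tau <= N0], the weight lies between [1] and
      [E := exp (l * N0)]; and the distance of [(x, tau)] to [A * [0, N0]] is
      that of [x] to [A] ([set_dist_with_clock]).  Hence [psi1] still bounds the
      weighted function from below and [E * psi2] bounds it from above.
    - The weight is Lipschitz on [[0, N0]], and [V] is Lipschitz, thus bounded,
      near each point outside [A]; so the product is locally Lipschitz
      ([locally_lipschitz_clock_weight]).
    - Multiplying all gains by [E] turns the gain condition on the weighted
      functions into one that implies the original gain condition
      ([gain_max_weighted]).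
    - Along a flow the clock grows with speed [s <= delta], and the product rule
      lowers the decay rate by [l * s <= l * delta] ([dini_clock_weight]).
    - A jump lowers the clock by 1, hence the weight by the factor [exp (- l)],
      which adds [l] to [d]; the gain terms are multiplied by a weight that is
      at most [E]. *)

(** * Euclidean norm of a block vector *)

Section EuclideanNorm.
Context {R : realType}.

Lemma enorm_ge0 N (x : 'rV[R]_N) : 0 <= enorm x.
Proof. exact: sqrtr_ge0. Qed.

Lemma enorm0 N : enorm (0 : 'rV[R]_N) = 0.
Proof. by rewrite /enorm big1 ?sqrtr0// => k _; rewrite mxE expr0n. Qed.

Lemma enorm_row_mx N b (x : 'rV[R]_N) (t : 'rV[R]_b) :
  enorm (row_mx x t) =
  Num.sqrt (\sum_(k < N) x 0 k ^+ 2 + \sum_(k < b) t 0 k ^+ 2).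
Proof.
rewrite /enorm big_split_ord; congr (Num.sqrt (_ + _)).
  by apply: eq_bigr => k _; rewrite row_mxEl.
by apply: eq_bigr => k _; rewrite row_mxEr.
Qed.

Lemma enorm_lsubmx_le N b (z : 'rV[R]_(N + b)) : enorm (lsubmx z) <= enorm z.
Proof.
rewrite -{2}[z]hsubmxK enorm_row_mx ler_sqrt ?lerDl.
  by rewrite sumr_ge0// => k _; rewrite sqr_ge0.
by rewrite addr_ge0// sumr_ge0// => k _; rewrite sqr_ge0.
Qed.

Lemma enorm_row_mx0 N b (x : 'rV[R]_N) :
  enorm (row_mx x (0 : 'rV[R]_b)) = enorm x.
Proof.
rewrite enorm_row_mx [X in _ + X]big1 ?addr0// => k _.
by rewrite mxE expr0n.
Qed.

End EuclideanNorm.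

(** * The clock component *)

Section Clock.
Context {R : realType} {N : nat} {b : bool}.
Implicit Types (z y : 'rV[R]_(N + b)).

Lemma clockD z y : clock (z + y) = clock z + clock y.
Proof.
by rewrite /clock raddfD -big_split; apply: eq_bigr => k _; rewrite mxE.
Qed.

Lemma clockZ (h : R) z : clock (h *: z) = h * clock z.
Proof.
by rewrite /clock linearZ mulr_sumr; apply: eq_bigr => k _; rewrite mxE.
Qed.

Lemma clockB z y : clock (z - y) = clock z - clock y.
Proof. by rewrite -scaleN1r clockD clockZ mulN1r. Qed.

(** The bounds are multiples by the boolean [b] because the clock reads 0 when
    it is absent, whatever [lo] and [hi] are. *)
Lemma clock_itv (lo hi : R) z : clock_in lo hi z ->
  lo *+ b <= clock z <= hi *+ b.
Proof.
move=> zt; rewrite -[b in lo *+ b]card_ord -[b in hi *+ b]card_ord.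
rewrite -!sumr_const.
by apply/andP; split; apply: ler_sum => k _; have /andP[] := zt k.
Qed.

Lemma clock_ge0 (hi : R) z : clock_in 0 hi z -> 0 <= clock z.
Proof. by case/clock_itv/andP; rewrite mul0rn. Qed.

Lemma clock_le_enorm z : `|clock z| <= enorm z.
Proof.
rewrite -{2}[z]hsubmxK enorm_row_mx -sqrtr_sqr ler_sqrt; last first.
  by rewrite addr_ge0// sumr_ge0// => k _; rewrite sqr_ge0.
apply: ler_wpDl; first by rewrite sumr_ge0// => k _; rewrite sqr_ge0.
rewrite /clock; case: b z => z; first by rewrite !big_ord1.
by rewrite !big_ord0 expr0n.
Qed.

End Clock.

(** The Euclidean norm of [z - y] is at least that of its left block, with
    equality when [y] has the same clock value as [z]; and this choice of [y] is
    possible since that value lies in [[0, hi]]. *)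
Lemma set_dist_with_clock (R : realType) N (b : bool) (hi : R)
    (A : set 'rV[R]_N) (z : 'rV[R]_(N + b)) : A !=set0 -> clock_in 0 hi z ->
  set_dist (with_clock 0 hi A) z = set_dist A (lsubmx z).
Proof.
move=> [a0 Aa0] zt; apply/eqP; rewrite eq_le; apply/andP; split.
  apply: lb_le_inf; first by exists (enorm (lsubmx z - a0)), a0.
  move=> _ [a Aa <-]; apply: ge_inf.
    by exists 0 => _ [y _ <-]; exact: enorm_ge0.
  exists (row_mx a (rsubmx z)).
    by split; rewrite /clock_in ?row_mxKl ?row_mxKr.
  by rewrite -{1}[z]hsubmxK opp_row_mx add_row_mx subrr enorm_row_mx0.
apply: lb_le_inf.
  exists (enorm (z - row_mx a0 (rsubmx z))), (row_mx a0 (rsubmx z)) => //.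
  by split; rewrite /clock_in ?row_mxKl ?row_mxKr.
move=> _ [y [Ay _] <-].
apply: le_trans (enorm_lsubmx_le _); apply: ge_inf.
  by exists 0 => _ [a _ <-]; exact: enorm_ge0.
by exists (lsubmx y) => //; rewrite raddfB.
Qed.

(** * Comparison functions *)

Section ComparisonFunctions.
Context {R : realType}.
Implicit Types (alpha : R -> R) (k r : R).

Lemma classK_scale alpha k : 0 < k -> classK alpha ->
  classK (fun r => k * alpha r).
Proof.
move=> k0 [ac am a0]; split; last by rewrite a0 mulr0.
  by move=> x; apply: cvgM; [exact: cvg_cst|exact: ac].
by move=> r s r0 rs; rewrite ltr_pM2l ?am.
Qed.

Lemma classKoo_scale alpha k : 0 < k -> classKoo alpha ->
  classKoo (fun r => k * alpha r).
Proof.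
move=> k0 [aK au]; split; first exact: classK_scale.
move=> B; have [r r0 Br] := au (B / k); exists r => //.
by rewrite mulrC -ltr_pdivrMr.
Qed.

Lemma classK_le alpha r s : classK alpha -> 0 <= r -> r <= s ->
  alpha r <= alpha s.
Proof.
case=> _ am _ r0; rewrite le_eqVlt => /predU1P[->//|rs].
by rewrite ltW// am.
Qed.

End ComparisonFunctions.

(** * Exponential weights *)

(** The tangent of the convex function [expR] at [t] lies below its graph.  This
    one bound gives both the Lipschitz constant of the weight and the
    derivative of the weight along flows. *)
Lemma expRB_le (R : realType) (s t : R) :
  expR t - expR s <= (t - s) * expR t.
Proof.
have := expR_ge1Dx (s - t).
by rewrite expRD expRN ler_pdivlMr ?expR_gt0//; lra.
Qed.

Lemma expR_lipschitz (R : realType) (T s t : R) : s <= T -> t <= T ->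
  `|expR s - expR t| <= expR T * `|s - t|.
Proof.
wlog st : s t / s <= t => [wlg sT tT|sT tT].
  have [/wlg|/ltW/wlg] := leP s t; first exact.
  by rewrite distrC [`|s - t|]distrC; apply.
rewrite distrC [`|s - t|]distrC !ger0_norm ?subr_ge0 ?ler_expR//.
by rewrite (le_trans (expRB_le _ _))// mulrC ler_wpM2r ?subr_ge0 ?ler_expR.
Qed.

Definition clock_weight (R : realType) N (b : bool) (l : R)
    (V : 'rV[R]_N -> R) (z : 'rV[R]_(N + b)) : R :=
  expR (l * clock z) * V (lsubmx z).
Arguments clock_weight {R N} b l V z.

(** A product of Lipschitz and bounded functions: [e^T] bounds the weight, [B]
    bounds [V] near [x], and [`|K|] and [e^T * l] are Lipschitz constants of
    [V] and of the weight. *)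
Lemma locally_lipschitz_clock_weight (R : realType) N (b : bool) (l hi : R)
    (X A : set 'rV[R]_N) (V : 'rV[R]_N -> R) : 0 <= l ->
  locally_lipschitz_outside X A V ->
  locally_lipschitz_outside (with_clock 0 hi X) (with_clock 0 hi A)
    (clock_weight b l V).
Proof.
move=> l0 lipV.
have proj z : (with_clock 0 hi X `\` with_clock 0 hi A) z ->
    (X `\` A) (lsubmx z) /\ @clock_in _ N b 0 hi z.
  by move=> [[Xz zt] nA]; split=> //; split=> // Az; exact: nA.
move=> x /proj[XAx _]; have [K [e [e0 Ke]]] := lipV _ XAx.
have x_near : enorm (lsubmx x - lsubmx x) < e by rewrite subrr enorm0.
pose T := l * (hi *+ b); pose B := `|V (lsubmx x)| + `|K| * e.
exists (expR T * (`|K| + B * l)), e.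
split=> // y z /proj[XAy yt] /proj[XAz zt] ye ze.
have near w : enorm (w - x) < e -> enorm (lsubmx w - lsubmx x) < e.
  by apply: le_lt_trans; rewrite -raddfB; exact: enorm_lsubmx_le.
have KV v w : (X `\` A) v -> (X `\` A) w -> enorm (v - lsubmx x) < e ->
    enorm (w - lsubmx x) < e -> `|V v - V w| <= `|K| * enorm (v - w).
  move=> XAv XAw ve we; apply: le_trans (Ke _ _ XAv XAw ve we) _.
  by rewrite ler_wpM2r ?enorm_ge0 ?ler_norm.
have T_ge w : @clock_in _ N b 0 hi w -> l * clock w <= T.
  by move=> /clock_itv/andP[_ ?]; rewrite ler_wpM2l.
have VzB : `|V (lsubmx z)| <= B.
  have -> : V (lsubmx z) = V (lsubmx x) + (V (lsubmx z) - V (lsubmx x)) by ring.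
  apply: le_trans (ler_normD _ _) _; rewrite lerD2l.
  apply: le_trans (KV _ _ XAz XAx (near _ ze) x_near) _.
  by rewrite ler_wpM2l// ltW// near.
rewrite /clock_weight.
have -> : expR (l * clock y) * V (lsubmx y) -
    expR (l * clock z) * V (lsubmx z) =
  expR (l * clock y) * (V (lsubmx y) - V (lsubmx z)) +
  (expR (l * clock y) - expR (l * clock z)) * V (lsubmx z) by ring.
apply: le_trans (ler_normD _ _) _; rewrite !normrM -mulrA mulrDl mulrDr.
apply: lerD.
  rewrite ger0_norm ?expR_ge0// ler_pM ?expR_ge0// ?ler_expR ?T_ge//.
  apply: le_trans (KV _ _ XAy XAz (near _ ye) (near _ ze)) _.
  by rewrite ler_wpM2l// -raddfB enorm_lsubmx_le.
have -> : expR T * (B * l * enorm (y - z)) =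
  expR T * (l * enorm (y - z)) * B by ring.
apply: ler_pM => //.
apply: le_trans (expR_lipschitz (T_ge _ yt) (T_ge _ zt)) _.
rewrite ler_wpM2l ?expR_ge0// -mulrBr normrM (ger0_norm l0) ler_wpM2l//.
by rewrite -clockB clock_le_enorm.
Qed.

(** * Dini derivatives *)

Lemma limf_esup_leP (T : choiceType) (X : filteredType T) (R : realType)
    (f : X -> \bar R) (F : set (set X)) (a : R) : Filter F ->
  (limf_esup f F <= a%:E)%E <->
  forall e, 0 < e -> F [set x | (f x <= (a + e)%:E)%E].
Proof.
move=> FF; split=> [fa e e0|fa].
  have /ereal_inf_lt[_ [P FP <-] Pa] : (limf_esup f F < (a + e)%:E)%E.
    by apply: le_lt_trans fa _; rewrite lte_fin ltrDl.
  apply: filterS FP => x Px; apply: le_trans (ltW Pa).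
  by apply: ereal_sup_ubound; exists x.
apply/lee_addgt0Pr => e e0; apply: ge_ereal_inf.
eexists; first by exists [set x | (f x <= (a + e)%:E)%E]; [exact: fa|].
by apply: ge_ereal_sup => _ [x fx <-]; rewrite -EFinD.
Qed.

(** This also covers directions along which no small step stays in [X]: then the
    implication is vacuous and the limsup is [-oo]. *)
Lemma dini_leP (R : realType) N (X : set 'rV[R]_N) V x y (a : R) :
  (dini X V x y <= a%:E)%E <->
  forall e, 0 < e -> \forall h \near 0^'+,
    X (x + h *: y) -> V (x + h *: y) - V x <= (a + e) * h.
Proof.
rewrite /dini limf_esup_leP; split=> Va e e0.
  have Vae : \forall h \near 0^'+, X (x + h *: y) ->
      (((V (x + h *: y) - V x) / h)%:E <= (a + e)%:E)%E by exact: Va.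
  near=> h => Xh; rewrite -ler_pdivrMr//.
  by rewrite -lee_fin; move: Xh; near: h.
have Vae := Va e e0.
suff : \forall h \near 0^'+, X (x + h *: y) ->
  (((V (x + h *: y) - V x) / h)%:E <= (a + e)%:E)%E by [].
by near=> h => Xh; rewrite lee_fin ler_pdivrMr//; move: Xh; near: h.
Unshelve. all: by end_near. Qed.

(** With [s = l * clock y], the difference quotient of the weighted function is
    [E * (e^(h s) * (V x' - V x) / h + V x * (e^(h s) - 1) / h)], and
    [e^(h s) - 1 <= h s e^(h s)], so an upper bound [a * V x + e'] on the
    quotient of [V] gives [E * e^(h s) * ((a + s) * V x + e')].  The factor
    [e^(h s)] tends to 1. *)
Lemma dini_clock_weight (R : realType) N (b : bool) (l hi a : R)
    (X : set 'rV[R]_N) (V : 'rV[R]_N -> R) (z y : 'rV[R]_(N + b)) :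
  0 <= V (lsubmx z) ->
  (dini X V (lsubmx z) (lsubmx y) <= (a * V (lsubmx z))%:E)%E ->
  (dini (with_clock 0 hi X) (clock_weight b l V) z y <=
    ((a + l * clock y) * clock_weight b l V z)%:E)%E.
Proof.
move=> V0 /dini_leP Va; apply/dini_leP => e e0.
set s := l * clock y; set E := expR (l * clock z); set v := V (lsubmx z).
have E0 : 0 < E by exact: expR_gt0.
(* Half of the error goes to the limsup of [V], half to [e^(h s) --> 1]. *)
pose q := (a + s) * v + e / E / 2.
have e2 : 0 < e / E / 2 by rewrite !divr_gt0.
have Vae := Va _ e2.
have small : \forall h \near 0^'+, q * expR (h * s) < (a + s) * v + e / E.
  suff cq : q * expR (h * s) @[h --> 0^'+] --> q.
    apply: (cvgr_lt q) => //; rewrite /q ltrD2l ltr_pdivrMr//.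
    by rewrite ltr_pMr ?divr_gt0// ltr1n.
  apply: cvg_at_right_filter.
  rewrite -[X in _ --> X]mulr1; apply: cvgM; first exact: cvg_cst.
  rewrite -expR0; apply: continuous_cvg; first exact: continuous_expR.
  rewrite -[X in _ --> X](mul0r s).
  by apply: cvgM; [exact: cvg_id|exact: cvg_cst].
near=> h => -[Xh _].
have h0 : 0 < h by near: h; exact: nbhs_right_gt.
have shh : lsubmx (z + h *: y) = lsubmx z + h *: lsubmx y.
  by rewrite linearD linearZ.
rewrite /clock_weight clockD clockZ -/E -/v shh mulrDr mulrCA -/s.
rewrite expRD -/E; rewrite shh in Xh.
have VV : V (lsubmx z + h *: lsubmx y) - v <= (a * v + e / E / 2) * h.
  by move: Xh; near: h.
have ee : expR (h * s) - 1 <= h * s * expR (h * s).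
  by have := expRB_le 0 (h * s); rewrite expR0 subr0.
have qh : q * expR (h * s) <= (a + s) * v + e / E by apply: ltW; near: h.
set x := expR (h * s) in ee qh *.
have x0 : 0 < x by exact: expR_gt0.
set V' := V _ in VV *.
have -> : E * x * V' - E * v = E * (x * (V' - v) + (x - 1) * v) by ring.
have -> : ((a + s) * (E * v) + e) * h = E * (((a + s) * v + e / E) * h).
  by field; rewrite gt_eqF.
rewrite ler_pM2l//; apply: (@le_trans _ _ (q * x * h));
  last by rewrite ler_pM2r.
have -> : q * x * h = x * ((a * v + e / E / 2) * h) + h * s * x * v.
  by rewrite /q; ring.
by apply: lerD; [rewrite ler_pM2l|rewrite ler_wpM2r].
Unshelve. all: by end_near. Qed.

(** * Bounds on the weighted function *)

Section ClockWeight.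
Context {R : realType} {N : nat} {b : bool}.
Variables (l : R) (V : 'rV[R]_N -> R) (z : 'rV[R]_(N + b)).
Hypotheses (l0 : 0 <= l) (V0 : 0 <= V (lsubmx z)).

Lemma expR_clock_le (hi : R) : 0 <= hi -> clock_in 0 hi z ->
  expR (l * clock z) <= expR (l * hi).
Proof.
move=> hi0 zt; rewrite ler_expR ler_wpM2l//.
have /andP[_ /le_trans] := clock_itv zt; apply.
by case: b; rewrite ?mulr1n ?mulr0n.
Qed.

Lemma clock_weight_le (hi : R) : 0 <= hi -> clock_in 0 hi z ->
  clock_weight b l V z <= expR (l * hi) * V (lsubmx z).
Proof. by move=> hi0 zt; rewrite ler_wpM2r// expR_clock_le. Qed.

Lemma clock_weight_ge (hi : R) : clock_in 0 hi z ->
  V (lsubmx z) <= clock_weight b l V z.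
Proof.
move=> zt; rewrite ler_peMl// -expR0 ler_expR mulr_ge0//.
exact: clock_ge0 zt.
Qed.

End ClockWeight.

(** * The augmented interconnection *)

Section Augmentation.
Context (R : realType) (n M : nat) (S : interconnection R n M).
Context (V : forall j : 'I_n, 'rV[R]_(state_dim S j) -> R).
Arguments V : clear implicits.
Context (I : {pred 'I_n}) (N0 : 'I_n -> nat) (delta l : 'I_n -> R) (i : 'I_n).
Hypotheses (l0 : forall j, 0 <= l j) (li : i \notin I -> l i = 0).
Hypothesis V0 : forall j x, state_space S j x -> 0 <= V j x.

Local Notation aug := (augmented S I N0 delta).

Definition weighted : forall j, 'rV[R]_(state_dim aug j) -> R :=
  fun j z => clock_weight (j \in I) (l j) (V j) z.

(** Gains are nondecreasing and [V j] is at most its weighted version, so each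
    term of the left maximum is bounded by the corresponding term on the
    right. *)
Lemma gain_max_weighted (chi : 'I_n -> R -> R) (chiu : R -> R) (E : R)
    (z : state aug) u :
  0 < E -> (forall j, j != i -> classK (chi j)) ->
  (forall r, 0 <= r -> chi i r = 0) -> (forall j, state_space aug j (z j)) ->
  E * gain_max V chi chiu (xpart R n M S I z) u <=
  gain_max weighted (fun j r => if j == i then 0 else E * chi j r)
    (fun r => E * chiu r) z u.
Proof.
move=> E0 chiK chii Xz; rewrite /gain_max maxr_pMr ?(ltW E0)//.
rewrite ge_max !le_max lexx orbT andbT; apply/orP; left.
rewrite -ler_pdivlMl//; apply: bigmax_le => [|j _].
  by rewrite mulr_ge0 ?invr_ge0 ?(ltW E0)// bigmax_ge_id.
rewrite ler_pdivlMl//; set F := BIG_F.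
apply: le_trans (le_bigmax 0 F j); rewrite /F.
have [Xzj ztj] := Xz j.
case: eqVneq => [->|ji]; first by rewrite chii ?mulr0//; have [/V0] := Xz i.
rewrite ler_pM2l//; apply: classK_le; [exact: chiK|exact: V0|].
by apply: clock_weight_ge ztj; rewrite ?V0.
Qed.

(** The two cases of the theorem at once: where there is no clock, [l i = 0]
    turns the constants into those of the original subsystem. *)
Lemma candidate_weighted (A : set 'rV[R]_(state_dim S i)) (c d : R) chi chiu :
  A !=set0 -> candidate_exp_ISS_Lyapunov V A c d chi chiu ->
  @candidate_exp_ISS_Lyapunov R n M aug weighted i
    (@with_clock R (state_dim S i) (i \in I) 0 (N0 i)%:R A)
    (c - l i * delta i) (d + l i)
    (fun j r => if j == i then 0 else expR (l i * (N0 i)%:R) * chi j r)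
    (fun r => expR (l i * (N0 i)%:R) * chiu r).
Proof.
move=> A0 [[_ Vlip] [psi1 [psi2 [psi1K psi2K psiV]]]].
move=> [chiK chii chiuK] Vflow Vjump.
pose E := expR (l i * (N0 i)%:R).
have E0 : 0 < E by exact: expR_gt0.
split.
- split; last exact: locally_lipschitz_clock_weight.
  by move=> z [Xz _]; rewrite mulr_ge0 ?expR_ge0 ?V0.
- exists psi1, (fun r => E * psi2 r); split => //; first exact: classKoo_scale.
  move=> z [Xz zt]; rewrite set_dist_with_clock//.
  have /andP[V1 V2] := psiV _ Xz.
  rewrite (le_trans V1) ?(clock_weight_ge (l0 i) _ zt) ?V0//=.
  rewrite (le_trans (clock_weight_le (l0 i) _ _ zt)) ?V0 ?ler0n//.
  by rewrite ler_pM2l.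
- split=> [j ji|r _|]; last exact: classK_scale.
    by rewrite (negPf ji); apply: classK_scale (chiK _ ji).
  by rewrite eqxx.
- move=> z u [Cz Cu] nA WG y [Fy yt].
  have Zz j : state_space aug j (z j) by apply: flow_dom_sub; exact: Cz.
  have [Xzi zti] := Zz i.
  have VG : gain_max V chi chiu (xpart R n M S I z) u <= V i (lsubmx (z i)).
    (* [E * G <= W <= E * V], and [E] cancels. *)
    rewrite -(ler_pM2l E0).
    apply: le_trans (gain_max_weighted _ _ E0 chiK chii Zz) _.
    apply: le_trans WG _.
    by apply: clock_weight_le => //; rewrite ?V0 ?ler0n.
  have nAx : ~ A (lsubmx (z i)) by move=> Ax; apply: nA; split.
  have Cx : flow_set (xpart R n M S I z) u by split=> // j; have [] := Cz j.
  have Vdot := Vflow _ _ Cx nAx VG _ Fy.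
  have Wdot := dini_clock_weight (l i) (N0 i)%:R (V0 Xzi) Vdot.
  apply: le_trans Wdot _.
  rewrite lee_fin ler_wpM2r ?mulr_ge0 ?expR_ge0 ?V0// opprB addrC lerD2r.
  have [->|delta_i] : l i = 0 \/ delta i *+ (i \in I) = delta i.
    by case: (boolP (i \in I)) => [_|/li]; [right|left].
    by rewrite !mul0r.
  by rewrite ler_wpM2l// -delta_i; have /andP[] := clock_itv yt.
- move=> z u [Dz Du] y [Gy ty].
  have Zz j : state_space aug j (z j) by apply: jump_dom_sub; exact: Dz.
  have [Xzi zti] := Zz i.
  have Dx : jump_set (xpart R n M S I z) u by split=> // j; have [] := Dz j.
  have ltau : l i * clock y = l i * clock (z i) - l i.
    rewrite /clock ty (eq_bigr (fun k => rsubmx (z i) 0 k - 1)); last first.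
      by move=> k _; rewrite !mxE.
    rewrite big_split sumr_const card_ord mulrDr; congr (_ + _).
    by case: (boolP (i \in I)) => [_|/li ->]; rewrite ?mul0r ?oppr0 ?mulrN1.
  have Eyz : expR (l i * clock y) <= E.
    apply: le_trans (expR_clock_le (l0 i) _ zti); last by rewrite ler0n.
    by rewrite ltau ler_expR lerBlDr lerDl.
  have G0 : 0 <= gain_max V chi chiu (xpart R n M S I z) u.
    by rewrite le_max bigmax_ge_id.
  rewrite /weighted /clock_weight.
  apply: (@le_trans _ _ (expR (l i * clock y) * Num.max _ _)).
    by rewrite ler_wpM2l ?expR_ge0//; exact: Vjump Gy.
  rewrite maxr_pMr ?expR_ge0// ge_max; apply/andP; split.
    rewrite le_max; apply/orP; left; rewrite !mulrA -!expRD ltau.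
    rewrite (_ : _ - l i - d = - (d + l i) + l i * clock (z i))//; ring.
  rewrite le_max; apply/orP; right.
  apply: le_trans (gain_max_weighted _ _ E0 chiK chii Zz).
  by rewrite ler_wpM2r.
Qed.

End Augmentation.
Arguments weighted {R n M S} V I N0 delta l j z.

Theorem proposition5 (R : realType) (n M : nat) (hn : (2 <= n)%N)
    (S : interconnection R n M)
    (V : forall j : 'I_n, 'rV[R]_(state_dim S j) -> R)
    (A : forall j : 'I_n, set 'rV[R]_(state_dim S j))
    (c d : 'I_n -> R)
    (chi : 'I_n -> 'I_n -> R -> R) (chiu : 'I_n -> R -> R)
    (hA0 : forall j, A j !=set0)
    (hAc : forall j, compact (A j))
    (hAX : forall j, A j `<=` state_space S j)
    (hV : forall j, candidate_exp_ISS_Lyapunov V (A j) (c j) (d j)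
                      (chi j) (chiu j))
    (N0 : 'I_n -> nat) (delta L : 'I_n -> R)
    (hN0 : forall j, j \in I_d d -> (1 <= N0 j)%N)
    (hdelta : forall j, j \in I_d d -> 0 < delta j)
    (hL : forall j, 0 <= L j) :
  forall i : 'I_n,
  exists tchiu : R -> R,
    @candidate_exp_ISS_Lyapunov R n M
      (augmented S (I_d d) N0 delta)
      (@W R n M S (I_d d) N0 delta L V) i
      (@with_clock R (state_dim S i) (i \in I_d d) 0 (N0 i)%:R (A i))
      (if i \in I_d d then c i - L i * delta i else c i)
      (if i \in I_d d then d i + L i else d i)
      (aug_gain (I_d d) N0 L chi i)
      tchiu.
Proof.
move=> i; pose l j := if j \in I_d d then L j else 0.
have l0 j : 0 <= l j by rewrite /l; case: ifP.
have li : i \notin I_d d -> l i = 0 by rewrite /l => /negPf ->.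
have V0 j x : state_space S j x -> 0 <= V j x.
  by have [[+ _] _ _ _ _] := hV j; exact.
exists (fun r => expR (l i * (N0 i)%:R) * chiu i r).
(* Stated for an abstract boolean because [i \in I_d d] also occurs in the
   types of the states. *)
have factor (b : bool) (a t v : R) : (if b then expR (a * t) * v else v) =
    expR ((if b then a else 0) * t) * v.
  by case: b; rewrite ?mul0r ?expR0 ?mul1r.
have -> : @W R n M S (I_d d) N0 delta L V = weighted V (I_d d) N0 delta l.
  apply: functional_extensionality_dep => j; apply/funext => z.
  exact: factor.
have -> : aug_gain (I_d d) N0 L chi i =
    fun j r => if j == i then 0 else expR (l i * (N0 i)%:R) * chi i j r.
  apply/funext => j; apply/funext => r.
  by rewrite /aug_gain; case: ifP => // _; exact: factor.
have -> : (if i \in I_d d then c i - L i * delta i else c i) =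
    c i - l i * delta i.
  by rewrite /l; case: ifP; rewrite ?mul0r ?subr0.
have -> : (if i \in I_d d then d i + L i else d i) = d i + l i.
  by rewrite /l; case: ifP; rewrite ?addr0.
exact: candidate_weighted.
Qed.
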